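(* Let $R$ be a (commutative, unital) reduced $f$-ring with bounded inversion. Then the lattice $BZ^{\circ}(R)$ is co-normal if and only if $R$ is a $PW$-ring.
   Context: An $f$-ring is a lattice-ordered ring $A$ such that $c(a\vee b)=(ca)\vee(cb)$ for all $a,b\in A$ and $c\ge 0$; it has bounded inversion if every element $\geq 1$ is invertible. For $a\in R$, $P_a$ is the intersection of all minimal prime ideals of $R$ containing $a$ (with $P_a=R$ if there are none). For a reduced $f$-ring $R$ with bounded inversion, $BZ^{\circ}(R)=\{P_a: a\in R\}$, partially ordered by inclusion, is a distributive lattice with $P_a\vee P_b=P_{a^2+b^2}$ and $P_a\wedge P_b=P_{ab}$, bottom element $P_0=0$ and top element $P_1=R$. A bounded distributive lattice $L$ is co-normal if for all $a,b\in L$ with $a\wedge b=0$ there exist $x,y\in L$ with $x\vee y=1$ and $x\wedge a=y\wedge b=0$. $R$ is a $PW$-ring if for all $a,b\in R$ with $aR\cap bR=0$ the ideal $\mathrm{Ann}(a)+\mathrm{Ann}(b)$ contains a regular element (non-zero-divisor), where $\mathrm{Ann}(a)=\{r\in R: ra=0\}$. *)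

(* Defs.v *)
From HB Require Import structures.
From mathcomp Require Import all_boot all_order all_algebra.
From mathcomp Require Import boolp classical_sets.

Set Implicit Arguments.
Unset Strict Implicit.
Unset Printing Implicit Defensive.

Import Order.TTheory GRing.Theory.

Local Open Scope classical_set_scope.
Local Open Scope ring_scope.

(* Rings are commutative and unital; the zero ring is not excluded, whence
   ComPzRing. The lattice order is part of the mixin because the hierarchy of
   ssrnum has no room for a join of Order.Lattice and GRing.ComPzRing; the
   Order.Lattice structure is recovered below. *)
HB.mixin Record ComPzRing_isLatticeOrdered R of GRing.ComPzRing R := {
  lring_le : rel R ;
  lring_meet : R -> R -> R ;
  lring_join : R -> R -> R ;
  lring_le_refl : reflexive lring_le ;
  lring_le_anti : antisymmetric lring_le ;
  lring_le_trans : transitive lring_le ;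
  lring_lexI : forall x y z,
    lring_le x (lring_meet y z) = lring_le x y && lring_le x z ;
  lring_leUx : forall x y z,
    lring_le (lring_join x y) z = lring_le x z && lring_le y z ;
  lring_leD2r : forall z x y, lring_le x y -> lring_le (x + z) (y + z) ;
  lring_mul_ge0 : forall x y : R,
    lring_le 0 x -> lring_le 0 y -> lring_le 0 (x * y)
}.

#[short(type="latticeRingType")]
HB.structure Definition LatticeRing :=
  { R of GRing.ComPzRing R & ComPzRing_isLatticeOrdered R }.

HB.mixin Record LatticeRing_isFRing R of LatticeRing R := {
  fring_mul_join_subproof : forall a b c : R, lring_le 0 c ->
    c * lring_join a b = lring_join (c * a) (c * b)
}.

#[short(type="fRingType")]
HB.structure Definition FRing := { R of LatticeRing R & LatticeRing_isFRing R }.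

#[non_forgetful_inheritance]
HB.instance Definition _ (R : fRingType) :=
  Order.Le_isPOrder.Build ring_display (FRing.sort R)
    (@lring_le_refl R) (@lring_le_anti R) (@lring_le_trans R).

#[non_forgetful_inheritance]
HB.instance Definition _ (R : fRingType) :=
  Order.POrder_MeetJoin_isLattice.Build ring_display (FRing.sort R)
    (@lring_lexI R) (@lring_leUx R).

Definition bounded_inversion (R : fRingType) : Prop :=
  forall x : R, (1 : R) <= x -> exists y, x * y = 1.

Section CommutativeRings.
Variable R : comPzRingType.
Implicit Types (I J Q : set R) (a b : R).

Definition reduced : Prop := forall (x : R) (n : nat), x ^+ n = 0 -> x = 0.

(* The ideals of ring_quotient.v are boolean predicates on nonzero rings. *)
Definition is_ideal I : Prop :=
  [/\ I 0, forall x y, I x -> I y -> I (x + y) & forall r x, I x -> I (r * x)].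

Definition is_prime_ideal Q : Prop :=
  [/\ is_ideal Q, ~ Q 1 & forall x y, Q (x * y) -> Q x \/ Q y].

Definition is_minimal_prime Q : Prop :=
  is_prime_ideal Q /\ forall J, is_prime_ideal J -> J `<=` Q -> J = Q.

(* An empty intersection is setT, as in the convention P_a = R when no minimal
   prime contains a. *)
Definition Pideal a : set R :=
  \bigcap_(Q in [set Q | is_minimal_prime Q /\ Q a]) Q.

Definition principal_ideal a : set R := range ( *%R a).

Definition Ann a : set R := [set r | r * a = 0].

Definition ideal_sum I J : set R := [set x + y | x in I & y in J].

Definition PW_ring : Prop := forall a b,
  principal_ideal a `&` principal_ideal b = [set 0] ->
  exists2 z, ideal_sum (Ann a) (Ann b) z & GRing.lreg z.

End CommutativeRings.

Definition co_normal d (L : tbDistrLatticeType d) : Prop :=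
  forall a b : L, (a `&` b = \bot)%O ->
  exists x y : L, [/\ x `|` y = \top, x `&` a = \bot & y `&` b = \bot]%O.

Section FRingTheory.
Variable R : fRingType.
Implicit Types (x y s t c : R).

Lemma fring_leD2r z x y : x <= y -> x + z <= y + z.
Proof. exact: lring_leD2r. Qed.

Lemma fring_mul_ge0 x y : (0 : R) <= x -> (0 : R) <= y -> (0 : R) <= x * y.
Proof. exact: lring_mul_ge0. Qed.

Lemma fring_mul_join a b c : (0 : R) <= c ->
  c * Order.join a b = Order.join (c * a) (c * b) :> R.
Proof. exact: fring_mul_join_subproof. Qed.

Let leD x y s t : x <= y -> s <= t -> x + s <= y + t.
Proof.
move=> xy st; apply: le_trans (fring_leD2r _ xy) _.
by rewrite ![y + _]addrC fring_leD2r.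
Qed.

Let sub_ge0 x y : ((0 : R) <= y - x) = (x <= y).
Proof.
apply/idP/idP => [/(fring_leD2r x)|/(fring_leD2r (- x))].
  by rewrite add0r subrK.
by rewrite subrr.
Qed.

Lemma fring_leM2l c x y : (0 : R) <= c -> x <= y -> c * x <= c * y.
Proof. by rewrite -(sub_ge0 x) -(sub_ge0 (c * x)) -mulrBr; apply: fring_mul_ge0. Qed.

Let leN x y : x <= y -> - y <= - x.
Proof. by rewrite -(sub_ge0 x) -(sub_ge0 (- y)) opprK addrC. Qed.

Let joinN x y : Order.join (- x) (- y) = - Order.meet x y.
Proof.
apply/le_anti/andP; split.
  by rewrite leUx !leN // ?leIl ?leIr.
rewrite -[leRHS]opprK leN // lexI.
by rewrite -[x in _ <= x]opprK -[y in _ && (_ <= y)]opprK !leN ?leUl ?leUr.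
Qed.

Lemma fring_mul_meet x y c :
  (0 : R) <= c -> c * Order.meet x y = Order.meet (c * x) (c * y).
Proof.
move=> c0; apply: oppr_inj.
by rewrite -mulrN -!joinN fring_mul_join // !mulrN.
Qed.

Lemma fring_disjointM x y c : (0 : R) <= c -> (0 : R) <= x -> (0 : R) <= y ->
  Order.meet x y = 0 -> Order.meet (c * x) y = 0.
Proof.
move=> c0 x0 y0 xy0; pose e : R := Order.join c 1.
have ce : c <= e by rewrite leUl.
have e1 : (1 : R) <= e by rewrite leUr.
apply/le_anti/andP; split; last by rewrite lexI y0 fring_mul_ge0.
rewrite -(mulr0 e) -xy0 fring_mul_meet ?(le_trans c0) // leI2 //.
  by rewrite ![_ * x]mulrC fring_leM2l.
by rewrite -[leLHS]mulr1 mulrC [leRHS]mulrC mulrC fring_leM2l.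
Qed.

Lemma fring_sqr_ge0 x : (0 : R) <= x ^+ 2.
Proof.
pose p : R := Order.join x 0; pose n := p - x.
have p0 : (0 : R) <= p by rewrite leUr.
have n0 : (0 : R) <= n by rewrite sub_ge0 leUl.
have pn0 : Order.meet p n = 0.
  apply/le_anti/andP; split; last by rewrite lexI p0.
  set m := Order.meet _ _.
  have : p <= p - m.
    rewrite {1}/p leUx sub_ge0 leIl andbT -sub_ge0 addrAC sub_ge0.
    exact: leIr.
  by rewrite -sub_ge0 addrAC subrr add0r => /leN; rewrite opprK oppr0.
have pn : p * n = 0.
  have h : Order.meet (n * p) n = 0 by exact: fring_disjointM.
  have := fring_disjointM p0 n0 (fring_mul_ge0 n0 p0) _.
  by rewrite meetC => /(_ h); rewrite [n * p]mulrC meetxx.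
have -> : x = p - n by rewrite /n opprB addrC subrK.
clearbody p n; have -> : (p - n) ^+ 2 = p * p + n * n.
  by rewrite expr2 mulrBl !mulrBr [n * p]mulrC pn subr0 sub0r opprK.
by rewrite -[leLHS]addr0 leD ?fring_mul_ge0.
Qed.

Lemma fring_exp_ge0 x k : (0 : R) <= x -> (0 : R) <= x ^+ k.
Proof.
move=> x0; case: k => [|k]; first by rewrite expr0 -(expr1n R 2) fring_sqr_ge0.
by elim: k => [|k IH]; rewrite ?expr1 // exprS fring_mul_ge0.
Qed.

Lemma fring_leXD s t k : (0 : R) <= s -> (0 : R) <= t -> s ^+ k <= (s + t) ^+ k.
Proof.
move=> s0 t0; have st0 : (0 : R) <= s + t by rewrite -[leLHS]addr0 leD.
elim: k => [|k IH]; first by rewrite !expr0.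
rewrite !exprS; apply: (@le_trans _ _ (s * (s + t) ^+ k)).
  exact: fring_leM2l.
rewrite mulrC [leRHS]mulrC fring_leM2l ?fring_exp_ge0 //.
by rewrite -[leLHS]addr0 leD.
Qed.

End FRingTheory.

Section MinimalPrimes.
Variable R : comPzRingType.
Implicit Types (Q A : set R) (a b : R).

Lemma prime_idealM Q a b : is_prime_ideal Q -> Q (a * b) <-> Q a \/ Q b.
Proof.
move=> [[_ _ QM] _ Qp]; split; first exact: Qp.
by move=> [Qa|Qb]; [rewrite mulrC|]; exact: QM.
Qed.

Lemma prime_idealX Q a n : is_prime_ideal Q -> Q (a ^+ n) -> Q a.
Proof.
move=> Qp; elim: n => [|n IH].
  by case: Qp => [[_ _ QM] _ _] Q1; rewrite -(mulr1 a); exact: QM.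
by rewrite exprS => /(prime_idealM _ _ Qp)[|/IH].
Qed.

Lemma prime_avoiding (S : set R) :
  S 1 -> (forall s t, S s -> S t -> S (s * t)) -> ~ S 0 ->
  exists2 A, is_prime_ideal A & forall s, S s -> ~ A s.
Proof.
move=> S1 SM S0.
pose P (I : set R) := [/\ forall x y, I x -> I y -> I (x + y),
  forall r x, I x -> I (r * x) & forall s, S s -> ~ I s].
have [F FP Ftot|A [[AD AM AS] Amax]] := @Zorn_bigcup R P.
  split.
  - move=> x y [I FI Ix] [J FJ Jy]; have [IJ|JI] := Ftot _ _ FI FJ.
      by exists J => //; case: (FP _ FJ) => JD _ _; apply: JD => //; exact: IJ.
    by exists I => //; case: (FP _ FI) => ID _ _; apply: ID => //; exact: JI.
  - by move=> r x [I FI Ix]; exists I => //; case: (FP _ FI) => _ + _; exact.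
  - by move=> s Ss [I FI Is]; case: (FP _ FI) => _ _ /(_ _ Ss).
have A0 : A 0.
  have [//|nA0] := pselect (A 0); exfalso.
  apply: (Amax [set 0]).
    split=> [x Ax|]; first by case: nA0; rewrite -(mul0r x); exact: AM.
    by move=> /(_ 0 erefl).
  split=> [x y -> ->|r x ->|s Ss s0]; rewrite /= ?addr0 ?mulr0 //.
  by apply: S0; rewrite -s0.
have meetS u : ~ A u -> exists i r, A i /\ S (i + r * u).
  move=> nAu; apply: contrapT => /forallNP h.
  apply: (Amax [set z | exists i r, A i /\ z = i + r * u]).
    split=> [x Ax|]; first by exists x, 0; rewrite mul0r addr0.
    by move=> BA; apply: nAu; apply: BA; exists 0, 1; rewrite mul1r add0r.
  split.
  - move=> _ _ [i [r [Ai ->]]] [j [q [Aj ->]]]; exists (i + j), (r + q).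
    by rewrite mulrDl addrACA; split=> //; exact: AD.
  - move=> q _ [i [r [Ai ->]]]; exists (q * i), (q * r).
    by rewrite mulrDr mulrA; split=> //; exact: AM.
  - move=> s Ss [i [r [Ai es]]]; have /forallNP/(_ r) := h i.
    by apply; rewrite -es.
exists A => //; split => //; first exact: AS.
move=> u v Auv; apply: contrapT => /not_orP[/meetS[i [r [Ai Si]]]].
move=> /meetS[j [q [Aj Sj]]]; apply: (AS _ (SM _ _ Si Sj)).
rewrite mulrDl; apply: (AD); first by rewrite mulrC; exact: AM.
rewrite mulrDr; apply: (AD); first exact: AM.
by rewrite mulrACA; exact: AM.
Qed.

Lemma minimal_prime_ann Q a : is_minimal_prime Q -> Q a ->
  exists x n, ~ Q x /\ x * a ^+ n = 0.
Proof.
move=> [Qp Qmin] Qa; apply: contrapT => h.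
have [_ Q1 QM] := Qp.
pose S := [set s | exists x n, ~ Q x /\ s = x * a ^+ n].
have [||[x [n [Qx e]]]|A Ap AS] := @prime_avoiding S.
- by exists 1, 0%N; rewrite expr0 mulr1.
- move=> _ _ [x [m [Qx ->]]] [y [n [Qy ->]]]; exists (x * y), (m + n)%N.
  by rewrite exprD mulrACA; split => // /QM[].
- by apply: h; exists x, n.
have AQ : A `<=` Q.
  move=> x Ax; apply: contrapT => Qx; apply: (AS x) => //.
  by exists x, 0%N; rewrite expr0 mulr1.
apply: (AS a); last by rewrite (Qmin _ Ap AQ).
by exists 1, 1%N; rewrite expr1 mul1r.
Qed.

Lemma PidealP a b :
  Pideal b a <-> forall Q, is_minimal_prime Q -> Q b -> Q a.
Proof. by split=> [h Q Qm Qb|h Q [Qm Qb]]; apply: h. Qed.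

Lemma sub_Pideal a b : Pideal a `<=` Pideal b <-> Pideal b a.
Proof.
split; first by apply; apply/PidealP.
by move=> /PidealP h x /PidealP ax; apply/PidealP => Q Qm /(h _ Qm)/(ax _ Qm).
Qed.

End MinimalPrimes.

Lemma minimal_prime_sum_sqr (R : fRingType) (Q : set R) (a b : R) :
  is_minimal_prime Q -> Q (a ^+ 2 + b ^+ 2) <-> Q a /\ Q b.
Proof.
move=> Qm; have [Qp _] := Qm; have [[Q0 QD QM] _ _] := Qp.
split; last first.
  by move=> [Qa Qb]; rewrite !expr2; apply: QD; apply: QM.
suff h (c d : R) : Q (c ^+ 2 + d ^+ 2) -> Q c.
  by move=> Qab; split; [exact: (h a b)|apply: (h b a); rewrite addrC].
move=> /(minimal_prime_ann Qm)[x [n [Qx xcd]]].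
have e : x ^+ 2 * (c ^+ 2) ^+ n = 0.
  apply/le_anti/andP; split; last first.
    apply: fring_mul_ge0; first exact: fring_sqr_ge0.
    exact/fring_exp_ge0/fring_sqr_ge0.
  have <- : x ^+ 2 * (c ^+ 2 + d ^+ 2) ^+ n = 0.
    by rewrite expr2 -mulrA xcd mulr0.
  by apply/fring_leM2l/fring_leXD; exact: fring_sqr_ge0.
have : Q (x ^+ 2 * (c ^+ 2) ^+ n) by rewrite e.
move=> /(prime_idealM _ _ Qp)[/(prime_idealX Qp)//|].
by do 2 move/(prime_idealX Qp).
Qed.

(* The lattice structure below exists for every f-ring; \bot = P_0 is the
   nilradical, which is 0 when R is reduced. *)
Definition BZ (R : fRingType) : Type := {I : set R | I \in range (@Pideal R)}.

HB.instance Definition _ (R : fRingType) := SubChoice.on (BZ R).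

(* The order is inherited from that of [set R], which is inclusion. *)
HB.instance Definition _ (R : fRingType) :=
  [SubChoice_isSubPOrder of BZ R by <: with set_display].

Section BZLattice.
Variable R : fRingType.
Implicit Types (a b c : R) (I J K : BZ R).

Definition BZ_of a : BZ R := exist _ (Pideal a) (mem_set (imageP (@Pideal R) I)).

Definition BZ_gen I : R := projT1 (cid2 (set_mem (valP I))).

Lemma BZ_genK I : BZ_of (BZ_gen I) = I.
Proof. by apply: val_inj; rewrite /= /BZ_gen; case: cid2. Qed.

Lemma BZ_leP a b : reflect (Pideal b a) (BZ_of a <= BZ_of b)%O.
Proof. by apply: (iffP (asboolP _)) => /sub_Pideal. Qed.

Definition BZ_meet I J : BZ R := BZ_of (BZ_gen I * BZ_gen J).

Definition BZ_join I J : BZ R := BZ_of (BZ_gen I ^+ 2 + BZ_gen J ^+ 2).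

Lemma BZ_meetP I J K : (I <= BZ_meet J K)%O = (I <= J)%O && (I <= K)%O.
Proof.
rewrite -{1 2 3}(BZ_genK I) -{2}(BZ_genK J) -{2}(BZ_genK K).
apply/BZ_leP/andP => [/PidealP h|[/BZ_leP/PidealP hJ /BZ_leP/PidealP hK]].
  by split; apply/BZ_leP/PidealP => Q Qm Qx; apply: h => //;
     apply/(prime_idealM _ _ Qm.1); [left|right].
by apply/PidealP => Q Qm /(prime_idealM _ _ Qm.1)[/(hJ _ Qm)|/(hK _ Qm)].
Qed.

Lemma BZ_joinP I J K : (BZ_join I J <= K)%O = (I <= K)%O && (J <= K)%O.
Proof.
rewrite -{1 2 3}(BZ_genK K) -{2}(BZ_genK I) -{2}(BZ_genK J).
apply/BZ_leP/andP => [/PidealP h|[/BZ_leP/PidealP hI /BZ_leP/PidealP hJ]].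
  by split; apply/BZ_leP/PidealP => Q Qm /(h _ Qm) /(minimal_prime_sum_sqr _ _ Qm)[].
apply/PidealP => Q Qm QK; apply/(minimal_prime_sum_sqr _ _ Qm).
by split; [exact: hI|exact: hJ].
Qed.

End BZLattice.

HB.instance Definition _ (R : fRingType) :=
  Order.POrder_MeetJoin_isLattice.Build set_display (BZ R)
    (@BZ_meetP R) (@BZ_joinP R).

Section BZDistr.
Variable R : fRingType.
Implicit Types (a b c : R) (I J K : BZ R).

Lemma BZ_eqP a b :
  BZ_of a = BZ_of b <-> forall Q, is_minimal_prime Q -> (Q a <-> Q b).
Proof.
split=> [/eqP|h].
  rewrite eq_le => /andP[/BZ_leP/PidealP ab /BZ_leP/PidealP ba] Q Qm.
  by split=> ?; [exact: ba|exact: ab].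
apply/eqP; rewrite eq_le; apply/andP.
by split; apply/BZ_leP/PidealP => Q Qm ?; apply/(h _ Qm).
Qed.

Lemma BZ_gen_of a Q : is_minimal_prime Q -> Q (BZ_gen (BZ_of a)) <-> Q a.
Proof. by move=> Qm; have /BZ_eqP := BZ_genK (BZ_of a); apply. Qed.

Lemma BZ_meetE a b : (BZ_of a `&` BZ_of b)%O = BZ_of (a * b).
Proof.
apply/BZ_eqP => Q Qm; have [Qp _] := Qm.
by rewrite !(prime_idealM _ _ Qp) !BZ_gen_of.
Qed.

Lemma BZ_joinE a b : (BZ_of a `|` BZ_of b)%O = BZ_of (a ^+ 2 + b ^+ 2).
Proof.
by apply/BZ_eqP => Q Qm; rewrite !(minimal_prime_sum_sqr _ _ Qm) !BZ_gen_of.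
Qed.

Fact BZ_meetUl : left_distributive (@Order.meet _ (BZ R)) Order.join.
Proof.
move=> I J K; rewrite -(BZ_genK I) -(BZ_genK J) -(BZ_genK K).
rewrite !(BZ_meetE, BZ_joinE); apply/BZ_eqP => Q Qm; have [Qp _] := Qm.
rewrite !(prime_idealM _ _ Qp, minimal_prime_sum_sqr _ _ Qm) ?BZ_gen_of //.
by tauto.
Qed.

Fact BZ_joinIl : left_distributive (@Order.join _ (BZ R)) Order.meet.
Proof.
move=> I J K; rewrite -(BZ_genK I) -(BZ_genK J) -(BZ_genK K).
rewrite !(BZ_meetE, BZ_joinE); apply/BZ_eqP => Q Qm; have [Qp _] := Qm.
rewrite !(prime_idealM _ _ Qp, minimal_prime_sum_sqr _ _ Qm) ?BZ_gen_of //.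
by tauto.
Qed.

Fact BZ_le0 I : (BZ_of (0 : R) <= I)%O.
Proof.
rewrite -(BZ_genK I); apply/BZ_leP/PidealP => Q Qm _.
by have [[[]]] := Qm.
Qed.

Fact BZ_le1 I : (I <= BZ_of (1 : R))%O.
Proof.
rewrite -(BZ_genK I); apply/BZ_leP/PidealP => Q Qm Q1.
by have [[_ /(_ Q1)]] := Qm.
Qed.

End BZDistr.

HB.instance Definition _ (R : fRingType) :=
  Order.Lattice_isDistributive.Build set_display (BZ R)
    (@BZ_meetUl R) (@BZ_joinIl R).

HB.instance Definition _ (R : fRingType) :=
  Order.hasBottom.Build set_display (BZ R) (@BZ_le0 R).

HB.instance Definition _ (R : fRingType) :=
  Order.hasTop.Build set_display (BZ R) (@BZ_le1 R).

(* Main.v *)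
Require Import Defs.
From HB Require Import structures.
From mathcomp Require Import all_boot all_order all_algebra.
From mathcomp Require Import boolp classical_sets.

(* In a reduced ring the minimal primes have intersection 0 and their union is
   the set of zero-divisors. Hence P_a = P_0 means a = 0 and P_a = R means that
   a is regular, so co-normality says: if ab = 0 then there are x in Ann(a) and
   y in Ann(b) with x^2 + y^2 regular. A minimal prime containing x^2 + y^2
   contains x and y, so x^2 + y^2 is regular as soon as x + y is; conversely
   x^2 + y^2 itself lies in Ann(a) + Ann(b). *)

Set Implicit Arguments.
Unset Strict Implicit.
Unset Printing Implicit Defensive.

Import Order.TTheory GRing.Theory.

Local Open Scope classical_set_scope.
Local Open Scope ring_scope.

Section MinimalPrimes.
Variable R : comPzRingType.
Implicit Types (Q S : set R) (a b c : R).

(* The complement of a maximal multiplicative set is a minimal prime. *)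
Lemma minimal_prime_avoiding c :
  (forall n, c ^+ n <> 0) -> exists2 Q, is_minimal_prime Q & ~ Q c.
Proof.
move=> cX.
(* The last condition is conditional because the empty chain has empty union. *)
pose P S := [/\ ~ S 0, forall s t, S s -> S t -> S (s * t)
  & forall s, S s -> S 1 /\ S c].
have [F FP Ftot|S [[S0 SM Sc] Smax]] := @Zorn_bigcup R P.
  split.
  - by move=> [I FI I0]; case: (FP _ FI).
  - move=> s t [I FI Is] [J FJ Jt]; have [IJ|JI] := Ftot _ _ FI FJ.
      by exists J => //; case: (FP _ FJ) => _ + _; apply=> //; exact: IJ.
    by exists I => //; case: (FP _ FI) => _ + _; apply=> //; exact: JI.
  - move=> s [I FI Is]; case: (FP _ FI) => _ _ /(_ _ Is)[I1 Ic].
    by split; exists I.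
(* An empty [S] would not be maximal: the powers of [c] form a larger member of [P]. *)
have [s Ss] : exists s, S s.
  apply: contrapT => /forallNP Se.
  apply: (Smax [set c ^+ n | n in [set: nat]]).
    split=> [x /Se//|]; move=> /(_ (c ^+ 1)) h.
    by apply: (Se (c ^+ 1)); apply: h; exists 1%N.
  split=> [[n _ /cX]//|_ _ [m _ <-] [n _ <-]|_ _].
    by exists (m + n)%N; rewrite ?exprD.
  by split; [exists 0%N; rewrite ?expr0|exists 1%N; rewrite ?expr1].
have {s Ss} [S1 {}Sc] := Sc _ Ss.
have [Q Qp SQ] := prime_avoiding S1 SM S0.
exists Q; last exact: SQ.
split=> // J Jp JQ; apply/seteqP; split=> // x Qx; apply: contrapT => Jx.
(* Otherwise the complement of [J] would properly extend [S]: it contains [S], which misses [Q], and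
   also [x], which lies in [Q]. *)
apply: (Smax (~` J)).
  by split=> [s Ss /JQ|/(_ x Jx) /SQ]; [exact: SQ|].
have [[J0 _ _] J1 _] := Jp.
split=> [|s t Js Jt /(prime_idealM _ _ Jp)[]//|_ _]; first exact.
by split=> // /JQ; exact: SQ.
Qed.

Hypothesis Rreduced : reduced R.

Lemma minimal_prime_eq0 c : (forall Q, is_minimal_prime Q -> Q c) -> c = 0.
Proof.
move=> h; apply: contrapT => c0.
have [n /Rreduced//|Q Qm] := @minimal_prime_avoiding c.
by apply; exact: h.
Qed.

(** An element of a minimal prime [Q] has a power killed by some [x] outside [Q], so it is not
    regular. Conversely, [c * (x - y) = 0] puts [x - y] in every minimal prime. *)
Lemma lreg_minimal_prime c :
  GRing.lreg c <-> forall Q, is_minimal_prime Q -> ~ Q c.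
Proof.
split=> [creg Q Qm Qc|h x y cxy].
  have [x [n [Qx xcn]]] := minimal_prime_ann Qm Qc.
  have x0 : x = 0 by apply: (lregX (n := n) creg); rewrite mulr0 mulrC.
  by apply: Qx; rewrite x0; have [[[]]] := Qm.
apply/eqP; rewrite -subr_eq0; apply/eqP/minimal_prime_eq0 => Q Qm.
have [Qp _] := Qm; have : Q (c * (x - y)).
  by rewrite mulrBr cxy subrr; have [[]] := Qp.
by move=> /(prime_idealM _ _ Qp)[/(h _ Qm)|].
Qed.

Lemma principal_idealI_eq0 a b :
  principal_ideal a `&` principal_ideal b = [set 0] <-> a * b = 0.
Proof.
split=> [h|ab0].
  have : (principal_ideal a `&` principal_ideal b) (a * b).
    by split; [exists b|exists a => //; rewrite mulrC].
  by rewrite h.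
apply/seteqP; split=> [_ [[r _ <-] [s _ e]]|_ ->].
  (* An element [a * r = b * s] has square [(b * s) * (a * r)], a multiple of [a * b]. *)
  apply: (Rreduced (n := 2)).
  by rewrite expr2 -{1}e mulrACA [b * a]mulrC ab0 mul0r.
by split; exists 0; rewrite ?mulr0.
Qed.

End MinimalPrimes.

Section ReducedFRing.
Variable R : fRingType.
Hypothesis Rreduced : reduced R.
Implicit Types a : R.

Lemma BZ_eq_bot a : BZ_of a = \bot%O <-> a = 0.
Proof.
split=> [/BZ_eqP h|->//]; apply: minimal_prime_eq0 => // Q Qm.
by apply/(h _ Qm); have [[[]]] := Qm.
Qed.

(** [\top] is [BZ_of 1], and no minimal prime contains 1. *)
Lemma BZ_eq_top a : BZ_of a = \top%O <-> GRing.lreg a.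
Proof.
rewrite lreg_minimal_prime //; split=> [/BZ_eqP h Q Qm /(h _ Qm)|h].
  by have [[]] := Qm.
by apply/BZ_eqP => Q Qm; split=> [/(h _ Qm)//|]; have [[]] := Qm.
Qed.

End ReducedFRing.

Theorem proposition4p14 (R : fRingType)
    (Rreduced : reduced R) (Rinv : bounded_inversion R) :
  co_normal (BZ R) <-> PW_ring R.
Proof.
split=> [cn a b /(principal_idealI_eq0 Rreduced) ab0|pw I J].
  have [|I [J]] := cn (BZ_of a) (BZ_of b).
    by rewrite BZ_meetE ab0.
  (* Passing to generators turns the three lattice equations into conditions on ring elements. *)
  rewrite -(BZ_genK I) -(BZ_genK J).
  move: (BZ_gen I) (BZ_gen J) => x y; rewrite !BZ_meetE BZ_joinE.
  move=> [/(BZ_eq_top Rreduced) xy_reg].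
  move=> /(BZ_eq_bot Rreduced) xa0 /(BZ_eq_bot Rreduced) yb0.
  exists (x ^+ 2 + y ^+ 2) => //.
  exists (x ^+ 2); first by rewrite /Ann /= expr2 -mulrA xa0 mulr0.
  by exists (y ^+ 2); rewrite // /Ann /= expr2 -mulrA yb0 mulr0.
rewrite -(BZ_genK I) -(BZ_genK J); move: (BZ_gen I) (BZ_gen J) => a b.
rewrite BZ_meetE => /(BZ_eq_bot Rreduced)/(principal_idealI_eq0 Rreduced)/pw.
move=> [_ [x xa0 [y yb0 <-]] xy_reg].
exists (BZ_of x), (BZ_of y); rewrite BZ_joinE !BZ_meetE xa0 yb0; split=> //.
apply/(BZ_eq_top Rreduced)/(lreg_minimal_prime Rreduced) => Q Qm.
move=> /(minimal_prime_sum_sqr _ _ Qm)[Qx Qy].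
have /(lreg_minimal_prime Rreduced)/(_ _ Qm) := xy_reg.
by apply; have [[[_ QD _] _ _] _] := Qm; exact: QD.
Qed.
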